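(* Let $U_i$, $i\ge1$, be an i.i.d. sequence of $\mathbb{R}$-valued random variables, and suppose that $M(\lambda)=\mathbb{E}(e^{\lambda U_1})<\infty$ for every $\lambda\in\mathbb{R}$. Let $H(\lambda)=\log M(\lambda)$ for $\lambda\in\mathbb{R}$, let $L$ be the Legendre transform of $H$, and suppose that $L$ is finite on $(0,\infty)$. Write $Y_n=\frac1n\sum_{i=1}^nU_i$ for $n\ge1$. Then for every $c>\mathbb{E}(U_1)$ and $\gamma\ge0$, $$\lim_{n\to\infty}\frac1n\log\min_{\lambda\ge\gamma}\mathbb{E}[\lambda(Y_n-c)+1]^+=\lim_{n\to\infty}\frac1n\log\mathbb{P}[Y_n>c]=-L(c).$$
   Context: $L(\beta)=\sup_{\alpha\in\mathbb{R}}(\alpha\beta-H(\alpha))$. For real $x$, $[x]^+=\max(x,0)$, and $\mathbb{E}[\lambda(Y_n-c)+1]^+$ denotes the expectation of $[\lambda(Y_n-c)+1]^+$. (The quantity $\min_{\lambda\ge0}\mathbb{E}[\lambda(Y_n-c)+1]^+$ is the buffered probability of exceedance of $Y_n$ at level $c$.) *)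

(* Defs.v *)
From HB Require Import structures.
From mathcomp Require Import all_boot all_order all_algebra finmap.
From mathcomp Require Import all_classical all_reals all_analysis.

Set Implicit Arguments.
Unset Strict Implicit.
Unset Printing Implicit Defensive.

Import Order.TTheory GRing.Theory Num.Theory.
Import numFieldNormedType.Exports.

Local Open Scope classical_set_scope.
Local Open Scope ring_scope.
Local Open Scope ereal_scope.

(* Product rule over every finite subfamily. *)
Definition mutually_independent (d : measure_display) (T : measurableType d)
    (R : realType) (P : probability T R) (U : nat -> {RV P >-> R}) : Prop :=
  forall (J : {fset nat}) (B : nat -> set R), (forall i, measurable (B i)) ->
    P (\bigcap_(i in [set` J]) (U i @^-1` B i)) =
    \prod_(i <- J) P (U i @^-1` B i).

Definition identically_distributed (d : measure_display) (T : measurableType d)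
    (R : realType) (P : probability T R) (U : nat -> {RV P >-> R}) : Prop :=
  forall (i j : nat) (B : set R), measurable B ->
    distribution P (U i) B = distribution P (U j) B.

Definition iid (d : measure_display) (T : measurableType d)
    (R : realType) (P : probability T R) (U : nat -> {RV P >-> R}) : Prop :=
  mutually_independent U /\ identically_distributed U.

Definition log_mgf (d : measure_display) (T : measurableType d)
    (R : realType) (P : probability T R) (X : {RV P >-> R}) (l : R) : \bar R :=
  lne ('M_P X l).

Definition legendre (R : realType) (H : R -> \bar R) (b : R) : \bar R :=
  ereal_sup [set (a * b)%:E - H a | a in [set: R]].

(* The sequence is indexed from 0: U 0, ..., U (n - 1) are the first n terms.
   Only the values at n >= 1 are meaningful. *)
Definition sample_mean (d : measure_display) (T : measurableType d)
    (R : realType) (P : probability T R) (U : nat -> {RV P >-> R}) (n : nat)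
    (w : T) : R :=
  (n%:R^-1 * \sum_(i < n) U i w)%R.

(* E[l (Y - c) + 1]^+ *)
Definition exceedance_cost (d : measure_display) (T : measurableType d)
    (R : realType) (P : probability T R) (Y : T -> R) (c l : R) : \bar R :=
  'E_P[fun w => Num.max (l * (Y w - c) + 1)%R 0%R].

(* The infimum of the costs over l >= g; it is a minimum when [is_attained]
   below holds. *)
Definition inf_exceedance_cost (d : measure_display) (T : measurableType d)
    (R : realType) (P : probability T R) (Y : T -> R) (c g : R) : \bar R :=
  ereal_inf [set exceedance_cost P Y c l | l in [set l : R | (g <= l)%R]].

Definition is_attained (d : measure_display) (T : measurableType d)
    (R : realType) (P : probability T R) (Y : T -> R) (c g : R) : Prop :=
  exists2 l : R, (g <= l)%R &
    exceedance_cost P Y c l = inf_exceedance_cost P Y c g.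

(* Main.v *)
Require Import Defs.
From HB Require Import structures.
From mathcomp Require Import all_boot all_order all_algebra finmap.
From mathcomp Require Import all_classical all_reals all_analysis.
From mathcomp Require Import measurable_realfun.
From mathcomp Require Import ring lra.

(** The upper bound is exponential domination: [max (x + 1) 0 <= expR x], so the
    cost at the multiplier [n * l] is at most [E expR (n * l * (Y_n - c))], which
    by independence is [expR (- n * (l * c - H l))]. Since [c] exceeds the mean,
    the supremum defining [L c] is reached at some [l > 0], and [n * l >= g] for
    [n] large. Conversely every cost dominates the indicator of [c < Y_n], so
    [P (c < Y_n) <= inf_exceedance_cost <= expR (- n * L c)] eventually, and it
    remains to prove the lower bound of Cramer's theorem for [P (c < Y_n)].

    That lower bound is proved without a change of measure, from the moment
    generating function of the sums alone. For [delta > 0] put [a = c + delta]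
    and let [l] minimize the moment generating function [phi] of [U 0 - a].
    Being a minimum of a smooth function, it satisfies
    [phi (l + t) <= phi l + t ^ 2 * C] for small [t] ([mgf_minimizer]). The sum
    [Z] of the first [n] variables [U i - a] has [E expR (x * Z) = phi x ^ n]
    ([mmt_gen_fun_centered_sum]), so the part of [E expR (l * Z)] carried by
    [|Z| >= n * delta] is at most
    [expR (- n * t * delta) * (phi (l + t) ^ n + phi (l - t) ^ n)], which is
    exponentially smaller than [phi l ^ n] ([prob_centered_sum_ge]). The rest
    lives on [|Z| < n * delta], which implies [c < Y_n], and there
    [expR (l * Z) <= expR (n * l * delta)]. As [l] stays bounded when [delta]
    tends to [0], the loss in the exponent vanishes in the limit
    ([prob_sample_mean_gt_ge]).

    Existence of [l] requires [U 0] to exceed [a] with positive probability.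
    This is what finiteness of [L] on the positive half-line provides: it excludes
    an essential upper bound for [U 0] ([prob_ge_gt0]). The same fact makes the
    cost coercive in the multiplier, whence attainment of the infimum
    ([is_attained_exceedance]). *)

Import Order.TTheory GRing.Theory Num.Theory.
Import numFieldNormedType.Exports.

Local Open Scope classical_set_scope.
Local Open Scope ring_scope.
Local Open Scope ereal_scope.

Set Implicit Arguments.
Unset Strict Implicit.
Unset Printing Implicit Defensive.

(** * Expectation of a product of independent variables *)

Section independence.
Context (d : measure_display) (T : measurableType d) (R : realType)
  (P : probability T R).

Import HBNNSimple.

Lemma integral_indic_comp (X : {RV P >-> R}) (B : set R) : measurable B ->
  \int[P]_w (\1_B (X w))%:E = P (X @^-1` B).
Proof.
move=> mB; rewrite -[in RHS](setIT (_ @^-1` _)) -integral_indic//.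
by rewrite -[X in measurable X]setTI; exact: measurable_funP.
Qed.

(** The two sides are the integrals of [f] against the image of the measure
    [G * P] under [X] and against a multiple of the law of [X]; two measures that
    agree on measurable sets integrate nonnegative functions equally. *)
Lemma integral_weighted_comp (G : T -> R) (K : R) (X : {RV P >-> R})
    (f : R -> R) :
  measurable_fun setT G -> (forall w, 0 <= G w)%R -> (0 <= K)%R ->
  (forall B, measurable B ->
     \int[P]_w (G w * \1_B (X w))%:E = K%:E * P (X @^-1` B)) ->
  measurable_fun setT f -> (forall x, 0 <= f x)%R ->
  \int[P]_w (G w * f (X w))%:E = K%:E * \int[P]_w (f (X w))%:E.
Proof.
move=> mG G0 K0 GX mf f0.
have mef : measurable_fun [set: R] (fun x => (f x)%:E) by exact/measurable_EFinP.
pose h := nnsfun_approx measurableT mef.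
have cvgh x : (h n x)%:E @[n --> \oo] --> (f x)%:E.
  exact: (cvg_nnsfun_approx measurableT mef (fun x _ => f0 x)).
have mhX n : measurable_fun [set: T] (fun w => h n (X w)).
  by apply: measurableT_comp => //; exact: measurable_funP.
have mhi n y : measurable (h n @^-1` [set y]).
  by rewrite -[X in measurable X]setTI; exact: measurable_funP.
have ndh x : {homo (fun n => h n x) : m n / (m <= n)%N >-> (m <= n)%R}.
  by move=> m n mn; exact/lefP/nd_nnsfun_approx.
have cvgl : \int[P]_w (G w * h n (X w))%:E @[n --> \oo] -->
    \int[P]_w (G w * f (X w))%:E.
  rewrite [X in _ --> X](_ : _ =
      \int[P]_w limn (fun n => (G w * h n (X w))%:E)).
    apply: cvg_monotone_convergence => //.
    - by move=> n; apply/measurable_EFinP; exact: measurable_funM.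
    - by move=> n w _; rewrite lee_fin mulr_ge0.
    - by move=> w _ m n mn; rewrite lee_fin ler_wpM2l ?ndh.
  apply: eq_integral => w _; apply/esym/cvg_lim => //.
  under eq_fun do rewrite EFinM.
  by rewrite EFinM; apply: cvgeZl.
have cvgr : \int[P]_w (h n (X w))%:E @[n --> \oo] --> \int[P]_w (f (X w))%:E.
  rewrite [X in _ --> X](_ : _ = \int[P]_w limn (fun n => (h n (X w))%:E)).
    apply: cvg_monotone_convergence => //.
    - by move=> n; exact/measurable_EFinP.
    - by move=> n w _; rewrite lee_fin.
    - by move=> w _ m n mn; rewrite lee_fin ndh.
  by apply: eq_integral => w _; apply/esym/cvg_lim.
rewrite -(cvg_lim _ cvgl)//.
apply/cvg_lim => //.
rewrite (_ : (fun n => _) = fun n => K%:E * \int[P]_w (h n (X w))%:E).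
  by apply: cvgeZl.
apply/funext => n.
have mX B : measurable B -> measurable (X @^-1` B).
  by move=> mB; rewrite -[X in measurable X]setTI; exact: measurable_funP.
have m1 y : measurable_fun setT (fun w => (\1_(h n @^-1` [set y]) (X w) : R)).
  by apply: measurableT_comp.
transitivity (\int[P]_w (\sum_(y \in range (h n))
    (y * (G w * \1_(h n @^-1` [set y]) (X w)))%:E)).
  apply: eq_integral => w _.
  rewrite (fimfunE (h n)) EFinM -fsumEFin// ge0_mule_fsumr.
    by apply: eq_fsbigr => y _; rewrite -EFinM mulrCA.
  by move=> y; rewrite EFinM; exact: nnfun_muleindic_ge0.
have ge0 y w : (0 <= y * \1_(h n @^-1` [set y]) (X w) :> R)%R.
  by rewrite -lee_fin EFinM; exact: nnfun_muleindic_ge0.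
rewrite ge0_integral_fsum//; last 2 first.
- move=> y; apply/measurable_EFinP.
  by apply: measurable_funM => //; exact: measurable_funM.
- by move=> y w _; rewrite lee_fin mulrCA mulr_ge0.
transitivity (K%:E * \int[P]_w (\sum_(y \in range (h n))
    (y * \1_(h n @^-1` [set y]) (X w))%:E)); last first.
  congr (_ * _); apply: eq_integral => w _.
  by rewrite (fimfunE (h n)) -fsumEFin.
rewrite ge0_integral_fsum//; last 2 first.
- move=> y; apply/measurable_EFinP; exact: measurable_funM.
- by move=> y w _; rewrite lee_fin.
rewrite ge0_mule_fsumr; last by move=> y; apply: integral_ge0 => w _; rewrite lee_fin.
apply: eq_fsbigr => y; rewrite inE => -[x _ hx].
have y0 : (0 <= y)%R by rewrite -hx.
under eq_integral do rewrite EFinM.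
rewrite ge0_integralZl//; last 2 first.
- by apply/measurable_EFinP; exact: measurable_funM.
- by move=> w _; rewrite lee_fin mulr_ge0.
under [X in _ = _ * X]eq_integral do rewrite EFinM.
rewrite ge0_integralZl//; last exact/measurable_EFinP.
rewrite GX// muleCA; congr (_ * (_ * _)).
by rewrite integral_indic_comp.
Qed.

(** Independence is assumed for events only; it is transported to nonnegative
    functions one factor at a time. The part [s1] of the index list carries the
    functions already treated and [s2] those that are still indicators. *)
Lemma independent_expectation_prod_indic (U : nat -> {RV P >-> R})
    (F : nat -> R -> R) (s1 s2 : seq nat) (B : nat -> set R) :
  mutually_independent U ->
  (forall i, measurable_fun setT (F i)) -> (forall i x, 0 <= F i x)%R ->
  (forall i, \int[P]_w (F i (U i w))%:E < +oo) ->
  (forall i, measurable (B i)) -> uniq (s1 ++ s2) ->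
  \int[P]_w ((\prod_(i <- s1) F i (U i w)) *
             \prod_(i <- s2) \1_(B i) (U i w))%:E =
  (\prod_(i <- s1) \int[P]_w (F i (U i w))%:E) *
  \prod_(i <- s2) P (U i @^-1` B i).
Proof.
move=> indep mF F0 Foo.
elim: s1 s2 B => [|k s1 IH] s2 B mB /=.
  move=> us; rewrite big_nil mul1e.
  have := indep [fset i in s2]%fset B mB.
  have ps : perm_eq (enum_fset [fset i in s2]%fset) s2.
    by apply: uniq_perm => //; move=> i; rewrite inE.
  rewrite (perm_big _ ps)/= => <-.
  rewrite -(setIT (\bigcap_(i in _) _)) -integral_indic//; last first.
    apply: fin_bigcap_measurable; first exact: finite_fset.
    move=> i _; rewrite -[X in measurable X]setTI; exact: measurable_funP.
  apply: eq_integral => w _; congr EFin.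
  rewrite big_nil mul1r indicE.
  have -> : (\prod_(i <- s2) \1_(B i) (U i w) =
      (all (fun i => U i w \in B i) s2)%:R :> R)%R.
    elim: s2 {us ps} => [|i s2 IHs]; first by rewrite big_nil.
    by rewrite big_cons IHs indicE /=; case: (U i w \in B i); rewrite ?mul1r ?mul0r.
  congr (nat_of_bool _)%:R; apply/allP/idP => [Bw|].
    by rewrite inE => i /=; rewrite inE => /Bw; rewrite inE.
  by rewrite inE => Bw i si; rewrite inE; apply: Bw; rewrite /= inE.
move=> us; have /= /andP[kn us'] : uniq (k :: s1 ++ s2) by [].
move: (kn); rewrite mem_cat negb_or => /andP[ks1 ks2].
rewrite big_cons.
pose G w : R := (\prod_(i <- s1) F i (U i w) * \prod_(i <- s2) \1_(B i) (U i w))%R.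
pose K := (\prod_(i <- s1) \int[P]_w (F i (U i w))%:E) *
  \prod_(i <- s2) P (U i @^-1` B i).
have mFU i : measurable_fun setT (fun w => F i (U i w)).
  by apply: measurableT_comp.
have m1 i A : measurable A -> measurable_fun setT (fun w => \1_A (U i w) : R).
  by move=> mA; apply: measurableT_comp.
have intF0 i : 0 <= \int[P]_w (F i (U i w))%:E.
  by apply: integral_ge0 => w _; rewrite lee_fin.
have mG : measurable_fun setT G.
  apply: measurable_funM; apply: measurable_prod => // i _; exact: m1.
have G0 w : (0 <= G w)%R by rewrite mulr_ge0// prodr_ge0.
have [Kfin K0] : K \is a fin_num /\ 0 <= K.
  split.
    rewrite fin_numM// prode_fin_num// => i _.
      by rewrite ge0_fin_numE.
    by rewrite fin_num_measure// -[X in measurable X]setTI; exact: measurable_funP.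
  by rewrite mule_ge0// prode_ge0.
have GB A : measurable A ->
    \int[P]_w (G w * \1_A (U k w))%:E = (fine K)%:E * P (U k @^-1` A).
  move=> mA; rewrite fineK//.
  (* the factor of index [k] is passed to the indicators, with [A] as its set *)
  pose B' i := if i == k then A else B i.
  have BB' i : i \in s2 -> B' i = B i.
    by rewrite /B'; case: eqVneq => // ->; rewrite (negbTE ks2).
  have B'k : B' k = A by rewrite /B' eqxx.
  transitivity (\int[P]_w ((\prod_(i <- s1) F i (U i w)) *
      \prod_(i <- k :: s2) \1_(B' i) (U i w))%:E).
    apply: eq_integral => w _; rewrite big_cons B'k /G -mulrA.
    congr (_ * _)%:E; rewrite mulrC; congr (_ * _)%R.
    by apply: eq_big_seq => i /BB' ->.
  rewrite IH; last 2 first.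
  - by move=> i; rewrite /B'; case: ifP.
  - by rewrite -cat1s uniq_catCA.
  rewrite big_cons B'k /K -muleA; congr (_ * _); rewrite muleC; congr (_ * _).
  by apply: eq_big_seq => i /BB' ->.
under eq_integral do rewrite big_cons -mulrA mulrC.
rewrite (integral_weighted_comp (K := fine K))//; last by rewrite fine_ge0.
by rewrite fineK// muleC muleA.
Qed.

Lemma independent_expectation_prod (U : nat -> {RV P >-> R})
    (F : nat -> R -> R) (s : seq nat) :
  mutually_independent U ->
  (forall i, measurable_fun setT (F i)) -> (forall i x, 0 <= F i x)%R ->
  (forall i, \int[P]_w (F i (U i w))%:E < +oo) -> uniq s ->
  \int[P]_w (\prod_(i <- s) F i (U i w))%:E =
  \prod_(i <- s) \int[P]_w (F i (U i w))%:E.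
Proof.
move=> indep mF F0 Foo us.
have := @independent_expectation_prod_indic U F s [::] (fun=> setT) indep mF F0
  Foo (fun=> measurableT).
rewrite cats0 => /(_ us); rewrite big_nil mule1 => <-.
by apply: eq_integral => w _; rewrite big_nil mulr1.
Qed.

End independence.

(** * Elementary bounds on the exponential *)

Section expR_inequalities.
Context (R : realType).
Implicit Types t x l : R.
Local Open Scope ring_scope.

Lemma normr_le_expRD x : `|x| <= expR x + expR (- x).
Proof.
have := expR_ge1Dx x; have := expR_ge1Dx (- x).
have := expR_gt0 x; have := expR_gt0 (- x).
by case: (ger0P x) => _; lra.
Qed.

Lemma sqr_le_expRD x : x ^+ 2 <= 2 * (expR x + expR (- x)).
Proof.
wlog x0 : x / 0 <= x => [H|].
  have [/H//|/ltW x0] := leP 0 x.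
  by have := H (- x); rewrite oppr_ge0 => /(_ x0); rewrite sqrrN opprK addrC.
have := expR_ge1Dxn 1 x0; rewrite (_ : 2`! = 2)%N// => h.
have := expR_gt0 (- x); lra.
Qed.

(** Multiply [1 - x <= expR (- x)] by [expR x] to get
    [expR x - 1 <= x * expR x], then use it or [1 + x <= expR x] according to the
    sign of [x]. *)
Lemma expR_le_quadratic x : expR x <= 1 + x + x ^+ 2 * (expR x + 1).
Proof.
have e0 := expR_gt0 x; have eN := expR_ge1Dx (- x).
have e1 : expR x * expR (- x) = 1 by rewrite -expRD subrr expR0.
have h : expR x - 1 <= x * expR x by nra.
have := expR_ge1Dx x; have [x0|x0] := leP 0 x; nra.
Qed.

Lemma expRM_le_expRD t x : `|t| <= 1 -> expR (t * x) <= expR x + expR (- x).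
Proof.
move=> t1; have : `|t * x| <= `|x| by rewrite normrM ler_piMl.
rewrite ler_norml => /andP[_ txx].
case: (ger0P x) txx => _ txx.
  by rewrite (le_trans (_ : _ <= expR x)) ?ler_expR ?lerDl ?expR_ge0.
by rewrite (le_trans (_ : _ <= expR (- x))) ?ler_expR ?lerDr ?expR_ge0.
Qed.

(** Second-order expansion in [t] whose remainder is [t ^ 2] times a combination
    of exponentials of multiples of [x], hence integrable under exponential
    moments. *)
Lemma expR_tilt_le l t x : `|t| <= 1 ->
  expR ((l + t) * x) <= expR (l * x) + t * (x * expR (l * x)) +
    t ^+ 2 * (4 * (expR ((l + 2) * x) + 2 * expR (l * x) + expR ((l - 2) * x))).
Proof.
move=> t1.
have -> : expR ((l + 2) * x) + 2 * expR (l * x) + expR ((l - 2) * x) =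
    expR (l * x) * (expR x + expR (- x)) ^+ 2.
  rewrite (_ : (l + 2) * x = l * x + (x + x)); last by ring.
  rewrite (_ : (l - 2) * x = l * x + (- x + - x)); last by ring.
  rewrite !expRD.
  have : expR x * expR (- x) = 1 by rewrite -expRD subrr expR0.
  move: (expR (l * x)) (expR x) (expR (- x)) => a b c bc; ring: bc.
(* [S] dominates [1], [expR (t * x)] and half of [x ^+ 2] *)
set S := expR x + expR (- x).
have S1 : 1 <= S by have := expR_ge1Dx x; have := expR_ge1Dx (- x); rewrite /S; lra.
have h := expR_le_quadratic (t * x).
have tS : expR (t * x) <= S by exact: expRM_le_expRD.
have xS : x ^+ 2 <= 2 * S by exact: sqr_le_expRD.
have {}h : expR (t * x) <= 1 + t * x + t ^+ 2 * (4 * S ^+ 2).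
  apply: le_trans h _; rewrite lerD2l exprMn -mulrA ler_wpM2l ?sqr_ge0//.
  apply: (@le_trans _ _ (2 * S * (S + S))).
    by rewrite ler_pM ?sqr_ge0 ?lerD// addr_ge0 ?expR_ge0.
  by rewrite expr2; lra.
rewrite mulrDl expRD.
have := expR_gt0 (l * x); move: (expR (l * x)) => a a0.
have := ler_wpM2l (ltW a0) h; lra.
Qed.

Lemma expR_tilt_ge l t x :
  expR (l * x) + t * (x * expR (l * x)) <= expR ((l + t) * x).
Proof.
rewrite mulrDl expRD; have := expR_gt0 (l * x); have := expR_ge1Dx (t * x).
by move: (expR (l * x)) (expR (t * x)) => a b; nra.
Qed.

End expR_inequalities.

(** * Moment generating functions *)

Section moment_generating_function.
Context (d : measure_display) (T : measurableType d) (R : realType)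
  (P : probability T R).
Implicit Types (W : T -> R) (l t : R).

Definition mgf W l : R := (\int[P]_w expR (l * W w))%R.

Lemma measurable_expRM W l : measurable_fun setT W ->
  measurable_fun setT (fun w => expR (l * W w)).
Proof.
by move=> mW; apply: measurableT_comp => //; exact: measurable_funM.
Qed.

Lemma mmt_gen_funE W l : 'M_P W l = \int[P]_w (expR (l * W w))%:E.
Proof.
by rewrite /mmt_gen_fun unlock; apply: eq_integral => w _ /=; rewrite mulrC.
Qed.

Lemma integrable_expRM W l : measurable_fun setT W -> 'M_P W l < +oo ->
  P.-integrable setT (fun w => (expR (l * W w))%:E).
Proof.
move=> mW; rewrite mmt_gen_funE => Moo; apply/integrableP; split.
  exact/measurable_EFinP/measurable_expRM.
by under eq_integral do rewrite gee0_abs ?lee_fin ?expR_ge0//.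
Qed.

Lemma mmt_gen_fun_mgf W l : measurable_fun setT W -> 'M_P W l < +oo ->
  'M_P W l = (mgf W l)%:E.
Proof.
move=> mW Moo; rewrite mmt_gen_funE /mgf /Rintegral fineK//.
by apply: integrable_fin_num => //; exact: integrable_expRM.
Qed.

Lemma integrable_EFinZ (k : R) (f : T -> R) :
  P.-integrable setT (fun w => (f w)%:E) ->
  P.-integrable setT (fun w => (k * f w)%:E).
Proof. exact: integrableZl. Qed.

Lemma integrable_EFinD (f g : T -> R) :
  P.-integrable setT (fun w => (f w)%:E) ->
  P.-integrable setT (fun w => (g w)%:E) ->
  P.-integrable setT (fun w => (f w + g w)%:E).
Proof. exact: integrableD. Qed.

Section finite_mgf.
Context (W : T -> R) (mW : measurable_fun setT W)
  (M_fin : forall l, 'M_P W l < +oo).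

Let intexp l : P.-integrable setT (fun w => (expR (l * W w))%:E).
Proof. exact: integrable_expRM. Qed.

Lemma integrable_mulexpRM l :
  P.-integrable setT (fun w => (W w * expR (l * W w))%:E).
Proof.
apply: (@le_integrable _ _ _ P setT measurableT _
    (fun w => (expR ((l + 1) * W w))%:E + (expR ((l - 1) * W w))%:E)).
- by apply/measurable_EFinP/measurable_funM => //; exact: measurable_expRM.
- move=> w _ /=; rewrite lee_fin normrM.
  rewrite (ger0_norm (expR_ge0 _)) [X in (_ <= X)%R]ger0_norm ?addr_ge0 ?expR_ge0//.
  have h := normr_le_expRD (W w).
  rewrite !mulrDl mul1r mulN1r !expRD -mulrDr [X in (X <= _)%R]mulrC.
  by rewrite ler_wpM2l ?expR_ge0.
- exact: integrableD.
Qed.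

Lemma integrable_of_mgf : P.-integrable setT (fun w => (W w)%:E).
Proof.
have := integrable_mulexpRM 0; apply: eq_integrable => // w _.
by rewrite mul0r expR0 mulr1.
Qed.

Lemma mgf0 : mgf W 0 = 1%R.
Proof.
rewrite /mgf /Rintegral; under eq_integral do rewrite mul0r expR0.
by rewrite integral_cst//= probability_setT mule1.
Qed.

(** The derivative of [mgf W] at [l], obtained by differentiating under the
    expectation; [mgf_ge_tangent] and [mgf_le_quadratic] make this precise. *)
Definition dmgf l : R := (\int[P]_w (W w * expR (l * W w)))%R.

Lemma dmgf0 : 'E_P[W] = (dmgf 0)%:E.
Proof.
rewrite unlock /dmgf /Rintegral; under [in RHS]eq_integral do rewrite mul0r expR0 mulr1.
by rewrite fineK// integrable_fin_num// integrable_of_mgf.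
Qed.

(** Jensen's inequality bounds it below by [expR (l * a)], with [a] the mean of
    [W]; it is obtained by integrating the tangent to [expR] at [l * a]. *)
Lemma mgf_gt0 l : (0 < mgf W l)%R.
Proof.
pose a := (\int[P]_w W w)%R.
have i0 := integrable_of_mgf.
have i1 : P.-integrable setT (fun=> (1 - l * a)%:E).
  exact: finite_measure_integrable_cst.
have i2 := integrable_EFinD (integrable_EFinZ l i0) i1.
have e : (expR (l * a) * \int[P]_w (l * W w + (1 - l * a)) = expR (l * a))%R.
  rewrite RintegralD; [|exact: measurableT|exact: integrable_EFinZ|exact: i1].
  rewrite (RintegralZl _ measurableT i0) Rintegral_cst//.
  have -> : fine (P [set: T]) = 1%R by rewrite probability_setT.
  rewrite mulr1.
  by rewrite -/a addrCA subrr addr0 mulr1.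
apply: lt_le_trans (expR_gt0 (l * a)) _.
rewrite -e -RintegralZl; [|exact: measurableT|exact: i2].
apply: le_Rintegral => //; [exact: integrable_EFinZ|exact: intexp|].
move=> w _; have -> : (l * W w = l * a + (l * W w - l * a))%R by ring.
rewrite [leRHS]expRD ler_wpM2l ?expR_ge0//.
have := expR_ge1Dx (l * W w - l * a)%R; lra.
Qed.

Lemma measurable_shift a : measurable_fun setT (fun w => W w - a)%R.
Proof. exact: measurable_funB. Qed.

Lemma mgf_shift a l :
  mgf (fun w => W w - a)%R l = (expR (- (l * a)) * mgf W l)%R.
Proof.
rewrite /mgf -(RintegralZl _ measurableT (intexp l)).
by apply: eq_Rintegral => w _; rewrite mulrBr addrC expRD.
Qed.

Lemma mmt_gen_fun_shift_lty a l : 'M_P (fun w => W w - a)%R l < +oo.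
Proof.
rewrite mmt_gen_funE.
under eq_integral do rewrite mulrBr addrC expRD EFinM.
rewrite ge0_integralZl//; last exact/measurable_EFinP/measurable_expRM.
by rewrite -mmt_gen_funE mmt_gen_fun_mgf// -EFinM ltry.
Qed.

Lemma expectation_shift_lt0 a : 'E_P[W] < a%:E ->
  'E_P[fun w => W w - a]%R < 0.
Proof.
rewrite unlock => Wa.
have ia : P.-integrable setT (fun=> a%:E).
  exact: finite_measure_integrable_cst.
rewrite (integralB_EFin measurableT integrable_of_mgf ia) integral_cst//=.
by rewrite probability_setT mule1 lteBlDr // add0e.
Qed.

Lemma mgf_ge_tangent l t : (mgf W l + t * dmgf l <= mgf W (l + t))%R.
Proof.
have i1 : P.-integrable setT (fun w => (t * (W w * expR (l * W w)))%:E).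
  by apply: integrable_EFinZ; exact: integrable_mulexpRM.
rewrite /mgf /dmgf -RintegralZl ?integrable_mulexpRM// 
  -RintegralD; [|exact: measurableT|exact: intexp|exact: i1].
apply: le_Rintegral => //; [exact: integrable_EFinD | exact: intexp |].
by move=> w _; exact: expR_tilt_ge.
Qed.

Lemma mgf_le_quadratic l : exists2 C : R, (0 <= C)%R & forall t, (`|t| <= 1)%R ->
  (mgf W (l + t) <= mgf W l + t * dmgf l + t ^+ 2 * C)%R.
Proof.
pose D w : R := (4 * (expR ((l + 2) * W w) + 2 * expR (l * W w) +
                   expR ((l - 2) * W w)))%R.
have intD : P.-integrable setT (fun w => (D w)%:E).
  apply: integrable_EFinZ; apply: integrable_EFinD => //.
  by apply: integrable_EFinD => //; exact: integrable_EFinZ.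
exists (\int[P]_w D w)%R.
  apply: Rintegral_ge0 => w _; rewrite /D.
  by rewrite !(mulr_ge0, addr_ge0) ?expR_ge0.
move=> t t1; rewrite /mgf /dmgf -RintegralZl ?integrable_mulexpRM//.
have i1 : P.-integrable setT (fun w => (t * (W w * expR (l * W w)))%:E).
  by apply: integrable_EFinZ; exact: integrable_mulexpRM.
have i2 : P.-integrable setT (fun w => (t ^+ 2 * D w)%:E).
  exact: integrable_EFinZ.
rewrite -(RintegralZl (t ^+ 2) measurableT intD).
rewrite -RintegralD; [|exact: measurableT|exact: intexp|exact: i1].
have i3 := integrable_EFinD (intexp l) i1.
rewrite -RintegralD; [|exact: measurableT|exact: i3|exact: i2].
apply: le_Rintegral => //; first exact: intexp.
  by apply: integrable_EFinD => //; exact: integrable_EFinD.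
by move=> w _; exact: expR_tilt_le.
Qed.

Lemma continuous_mgf : continuous (mgf W).
Proof.
move=> l; have [C C0 hC] := mgf_le_quadratic l.
pose K := (`|dmgf l| + C + 1)%R.
have K0 : (0 < K)%R by rewrite /K; have := normr_ge0 (dmgf l); lra.
apply/cvgrPdist_le => e e0.
have h1 : nbhs l (ball l 1%R) by exact: nbhsx_ballx.
have h2 : nbhs l (ball l (e / K)) by apply: nbhsx_ballx; rewrite divr_gt0.
apply: filterS2 h1 h2 => x; rewrite /ball /= distrC => /ltW x1 /ltW.
rewrite ler_pdivlMr// => xe.
rewrite distrC; have := hC _ x1; have := mgf_ge_tangent l (x - l).
rewrite addrCA subrr addr0; set t := (x - l)%R => lo hi.
have td : (`|t * dmgf l| <= `|t| * `|dmgf l|)%R by rewrite normrM.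
have t2 : (t ^+ 2 <= `|t|)%R.
  by rewrite -real_normK ?num_real// expr2 ler_piMl.
have : (`|mgf W x - mgf W l| <= `|t| * `|dmgf l| + `|t| * C)%R.
  have tC : (t ^+ 2 * C <= `|t| * C)%R by rewrite ler_wpM2r.
  have tC0 : (0 <= `|t| * C)%R by rewrite mulr_ge0.
  move: td; rewrite !ler_norml => /andP[? ?]; apply/andP; split; lra.
have := normr_ge0 t; rewrite /K in xe; lra.
Qed.

(** Gives the growth of [mgf W] at infinity once [W >= 1] has positive mass. *)
Lemma mgf_ge_prob l : (0 <= l)%R ->
  (expR l)%:E * P [set w | (1 <= W w)%R] <= (mgf W l)%:E.
Proof.
move=> l0; rewrite -mmt_gen_fun_mgf// mmt_gen_funE.
have m1 : measurable [set w | (1 <= W w)%R].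
  by rewrite -[X in measurable X]setTI; exact: measurable_fun_le.
rewrite -(setIT [set w | _]) -integral_indic//.
have mi : measurable_fun setT (fun w => (\1_[set w | (1 <= W w)%R] w : R)).
  exact: measurable_indic.
have mie := proj2 (measurable_EFinP _ _) mi.
rewrite -ge0_integralZl//.
apply: ge0_le_integral => //.
- by apply/measurable_EFinP; exact: measurable_funM.
- exact/measurable_EFinP/measurable_expRM.
- move=> w _; rewrite lee_fin indicE.
  case: (boolP (w \in _)) => [|_]; last by rewrite mulr0 expR_ge0.
  by rewrite inE /= mulr1 ler_expR => W1; rewrite ler_peMr.
Qed.

(** Left of [0] the tangent at [0], whose slope is the mean of [W] and hence
    negative, keeps [mgf W] above [mgf W 0 = 1]; beyond [- ln p] the mass of
    [1 <= W] does. So a minimum over the compact interval in between is global.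
    The derivative vanishes there, which turns the expansion of [mgf W] into a
    purely quadratic bound and excludes [l = 0]. The bound [expR l * p <= 1]
    depends on [W] only through [p], hence is uniform when [W] is shifted. *)
Lemma mgf_minimizer (p : R) : 'E_P[W] < 0 -> (0 < p)%R ->
  p%:E <= P [set w | (1 <= W w)%R] ->
  exists l : R, [/\ (0 < l)%R, (forall x, mgf W l <= mgf W x)%R,
    (expR l * p <= 1)%R &
    exists2 C : R, (0 <= C)%R & forall t, (`|t| <= 1)%R ->
      (mgf W (l + t) <= mgf W l + t ^+ 2 * C)%R].
Proof.
move=> EW p0 pP.
have d0 : (dmgf 0 < 0)%R by rewrite -lte_fin -dmgf0.
have ge_p l : (0 <= l)%R -> (expR l * p <= mgf W l)%R.
  move=> l0; rewrite -lee_fin EFinM (le_trans _ (mgf_ge_prob l0))//.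
  by rewrite lee_wpmul2l// lee_fin expR_ge0.
have p1 : (p <= 1)%R.
  by have := ge_p 0%R (lexx _); rewrite expR0 mul1r mgf0.
pose L := (- ln p)%R.
have L0 : (0 <= L)%R by rewrite oppr_ge0 ln_le0.
have eL : (expR L * p = 1)%R.
  by rewrite expRN lnK ?posrE// mulVf// gt_eqF.
have [l lL minl] : exists2 l, l \in `[0%R, L] &
    forall t, t \in `[0%R, L] -> (mgf W l <= mgf W t)%R.
  by apply: EVT_min => //; apply: continuous_subspaceT; exact: continuous_mgf.
have l1 : (mgf W l <= 1)%R.
  by rewrite -mgf0 minl// in_itv /= lexx.
have glob x : (mgf W l <= mgf W x)%R.
  have [x0|x0] := ltP x 0%R.
    rewrite (le_trans l1)//; have := mgf_ge_tangent 0 x.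
    rewrite mgf0 add0r; apply: le_trans; rewrite lerDl; nra.
  have [xL|xL] := leP x L; first by rewrite minl// in_itv /= x0.
  rewrite (le_trans l1)// (le_trans _ (ge_p _ x0))// -eL.
  by apply: ler_wpM2r; rewrite ?ler_expR ltW.
have [C C0 hC] := mgf_le_quadratic l.
have dl : dmgf l = 0%R.
  apply/eqP; apply/negPn/negP => dn0.
  (* a step of length [s] against the slope would decrease [mgf W]: the value of
     [s] makes [s * C < `|dmgf l|] while keeping [s <= 1] *)
  pose s := (`|dmgf l| / (`|dmgf l| + C + 1))%R.
  have D0 : (0 < `|dmgf l|)%R by rewrite normr_gt0.
  have den0 : (0 < `|dmgf l| + C + 1)%R by lra.
  have s0 : (0 < s)%R by rewrite divr_gt0.
  have s1 : (s <= 1)%R by rewrite ler_pdivrMr// mul1r; lra.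
  have sC : (s * (`|dmgf l| + C + 1) = `|dmgf l|)%R.
    by rewrite divfK// gt_eqF.
  pose t := (- (Num.sg (dmgf l) * s))%R.
  have t1 : (`|t| <= 1)%R.
    by rewrite normrN normrM normr_sg dn0 mul1r ger0_norm// ltW.
  have := hC _ t1; have := glob (l + t)%R.
  have -> : (t * dmgf l = - (s * `|dmgf l|))%R.
    by rewrite normrEsg /t; ring.
  have -> : (t ^+ 2 = s ^+ 2)%R.
    by rewrite /t sqrrN exprMn sqr_sg dn0 mul1r.
  nra.
exists l; split => //.
- rewrite lt_neqAle; move: lL; rewrite in_itv /= => /andP[-> _]; rewrite andbT.
  by apply/eqP => l0; move: d0 dl; rewrite -l0 => + d00; rewrite d00 ltxx.
- by rewrite (le_trans (ge_p _ _))//; move: lL; rewrite in_itv /= => /andP[].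
- by exists C => // t /hC; rewrite dl mulr0 addr0.
Qed.

End finite_mgf.
End moment_generating_function.

(** * Mass near the origin from exponential moments *)

Section local_lower_bound.
Context (d : measure_display) (T : measurableType d) (R : realType)
  (P : probability T R).

Lemma indic_bool (b : pred T) w : \1_[set w | b w] w = (b w)%:R :> R.
Proof. by rewrite indicE mem_setE. Qed.

Lemma measurable_ltr_fun (f g : T -> R) : measurable_fun setT f ->
  measurable_fun setT g -> measurable [set w | (f w < g w)%R].
Proof.
move=> mf mg; rewrite (_ : [set w | _] = ~` [set w | (g w <= f w)%R]).
  apply: measurableC; rewrite -[X in measurable X]setTI.
  exact: measurable_fun_le.
by apply/seteqP; split => w /=; rewrite ltNge => /negP.
Qed.

Lemma expR_tilt_indic (l t r z : R) : (0 <= l)%R -> (0 <= t)%R ->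
  (expR (l * z) - expR (- (t * r)) * (expR ((l + t) * z) + expR ((l - t) * z))
   <= expR (l * r) * (`|z| < r)%R%:R)%R.
Proof.
move=> l0 t0; rewrite mulrDr -!expRD.
set e1 := expR (- (t * r) + _); set e2 := expR (- (t * r) + _).
have [e10 e20] : (0 < e1 /\ 0 < e2)%R by split; exact: expR_gt0.
have [zr|zr] := ltP `|z|%R r.
  rewrite mulr1; have : (expR (l * z) <= expR (l * r))%R.
    by rewrite ler_expR ler_wpM2l// (le_trans (ler_norm _))// ltW.
  lra.
rewrite mulr0; suff : (expR (l * z) <= e1 \/ expR (l * z) <= e2)%R by case; lra.
rewrite !ler_expR; case: (ger0P z) zr => z0 zr; [left|right]; nra.
Qed.

(** The part of [E expR (l * Z)] outside [|Z| < r] is controlled by tilting a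
    little further, by [l + t] on the right and by [l - t] on the left. *)
Lemma prob_norm_lt_ge (Z : T -> R) (l t r : R) : measurable_fun setT Z ->
  (forall x, 'M_P Z x < +oo) -> (0 <= l)%R -> (0 <= t)%R ->
  (mgf P Z l - expR (- (t * r)) * (mgf P Z (l + t) + mgf P Z (l - t)) <=
   expR (l * r) * fine (P [set w | `|Z w| < r]))%R.
Proof.
move=> mZ Zoo l0 t0.
have intexp x := integrable_expRM mZ (Zoo x).
have mA : measurable [set w | (`|Z w| < r)%R].
  by apply: measurable_ltr_fun => //; exact: measurableT_comp.
have int1 : P.-integrable setT
    (fun w => (\1_[set w | (`|Z w| < r)%R] w : R)%:E).
  exact: integrable_indic.
have <- : (\int[P]_w \1_[set w | `|Z w| < r] w = fine (P [set w | `|Z w| < r]))%R.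
  by rewrite /Rintegral integral_indic// setIT.
have i1 := integrable_EFinD (intexp (l + t)%R) (intexp (l - t)%R).
have i2 := integrable_EFinZ (expR (- (t * r))) i1.
rewrite /mgf -RintegralD; [|exact: measurableT|exact: intexp|exact: intexp].
rewrite -RintegralZl; [|exact: measurableT|exact: i1].
rewrite -RintegralB; [|exact: measurableT|exact: intexp|exact: i2].
rewrite -RintegralZl; [|exact: measurableT|exact: int1].
apply: le_Rintegral => //.
- exact: (integrableB measurableT (intexp l) i2).
- exact: integrable_EFinZ.
- move=> w _; rewrite indic_bool.
  exact: expR_tilt_indic.
Qed.

End local_lower_bound.

(** * Sums of independent identically distributed variables *)

Section iid_sums.
Context (d : measure_display) (T : measurableType d) (R : realType)
  (P : probability T R) (U : nat -> {RV P >-> R}) (U_iid : iid U).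

Definition centered_sum (a : R) (n : nat) (w : T) : R :=
  (\sum_(i < n) (U i w - a))%R.

Lemma measurable_centered_sum a n : measurable_fun setT (centered_sum a n).
Proof.
by apply: measurable_sum => i; exact: measurable_funB.
Qed.

Lemma iid_integral (f : R -> R) i : measurable_fun setT f ->
  (forall x, 0 <= f x)%R ->
  \int[P]_w (f (U i w))%:E = \int[P]_w (f (U 0%N w))%:E.
Proof.
move=> mf f0.
have mef : measurable_fun [set: R] (fun x => (f x)%:E) by exact/measurable_EFinP.
have ef0 x : 0 <= (f x)%:E by rewrite lee_fin.
have := ge0_integral_distribution (U i) mef ef0.
have := ge0_integral_distribution (U 0%N) mef ef0.
rewrite /comp /= => <- <-; apply: eq_measure_integral => B mB _.
exact: (proj2 U_iid i 0%N B mB).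
Qed.

Lemma iid_prob (B : set R) i : measurable B ->
  P (U i @^-1` B) = P (U 0%N @^-1` B).
Proof. by move=> mB; exact: (proj2 U_iid i 0%N B mB). Qed.

Lemma mmt_gen_fun_centered_sum a l n : 'M_P (fun w => U 0%N w - a)%R l < +oo ->
  'M_P (centered_sum a n) l = (mgf P (fun w => U 0%N w - a)%R l ^+ n)%:E.
Proof.
move=> Moo.
pose F (i : nat) (x : R) := expR (l * (x - a)).
have mF i : measurable_fun setT (F i).
  apply: measurableT_comp => //; apply: measurable_funM => //.
  exact: measurable_funB.
have F0 i x : (0 <= F i x)%R by exact: expR_ge0.
have FE i : \int[P]_w (F i (U i w))%:E = (mgf P (fun w => U 0%N w - a)%R l)%:E.
  rewrite (iid_integral i (mF i) (F0 i)) -mmt_gen_fun_mgf//.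
    by rewrite mmt_gen_funE.
  exact: measurable_funB.
have Foo i : \int[P]_w (F i (U i w))%:E < +oo by rewrite FE ltry.
have [indep _] := U_iid.
have := independent_expectation_prod indep mF F0 Foo (iota_uniq 0 n).
under [RHS]eq_bigr do rewrite FE.
rewrite prodEFin big_const_seq count_predT size_iota iter_mulr_1 => <-.
rewrite mmt_gen_funE; apply: eq_integral => w _.
rewrite /centered_sum mulr_sumr expR_sum.
by rewrite -(big_mkord xpredT (fun i => F i (U i w))) /index_iota subn0.
Qed.

(** The mean is at least [b] as soon as each of the [n] independent terms is. *)
Lemma prob_sample_mean_ge b n : (0 < n)%N ->
  (fine (P [set w | (b <= U 0%N w)%R]) ^+ n)%:E <=
  P [set w | (b <= sample_mean U n w)%R].
Proof.
move=> n0; have [indep _] := U_iid.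
have mU i (B : set R) : measurable B -> measurable (U i @^-1` B).
  by move=> mB; rewrite -[X in measurable X]setTI; exact: measurable_funP.
pose B : set R := `[b, +oo[%classic.
have mB : measurable B by exact: measurable_itv.
have UB i : U i @^-1` B = [set w | (b <= U i w)%R].
  by apply/seteqP; split => w; rewrite /B /= in_itv /= andbT.
pose J := [fset i in iota 0 n]%fset.
have := indep J (fun=> B) (fun=> mB).
rewrite (eq_bigr (fun=> (fine (P [set w | (b <= U 0%N w)%R]))%:E)); last first.
  move=> i _; rewrite iid_prob// UB fineK// fin_num_measure// -UB.
  exact: mU.
rewrite prodEFin big_const_seq count_predT iter_mulr_1.
have -> : size J = n.
  by rewrite -[RHS](size_iota 0); apply: perm_size; apply: uniq_perm;
    rewrite ?iota_uniq// => i; rewrite inE.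
move=> <-; apply: le_measure.
- rewrite inE; apply: fin_bigcap_measurable; first exact: finite_fset.
  by move=> i _; exact: mU.
- rewrite inE -[X in measurable X]setTI; apply: measurable_fun_le => //.
  apply: measurable_funM => //; exact: measurable_sum.
- move=> w hw /=; rewrite /sample_mean ler_pdivlMl ?ltr0n//.
  rewrite mulr_natl -[n in (b *+ n)%R]card_ord -sumr_const.
  apply: ler_sum => i _; have := hw i; rewrite UB; apply.
  by rewrite /= !inE mem_iota /= add0n ltn_ord.
Qed.

End iid_sums.

(** * The exceedance cost *)

Section exceedance.
Context (d : measure_display) (T : measurableType d) (R : realType)
  (P : probability T R).
Implicit Types (Y : T -> R) (c l g : R).

Lemma measurable_hinge Y c l : measurable_fun setT Y ->
  measurable_fun setT (fun w => Num.max (l * (Y w - c) + 1)%R 0%R).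
Proof.
move=> mY; apply: measurable_maxr => //; apply: measurable_funD => //.
by apply: measurable_funM => //; exact: measurable_funB.
Qed.

Lemma exceedance_cost_integral Y c l : exceedance_cost P Y c l =
  \int[P]_w (Num.max (l * (Y w - c) + 1)%R 0%R)%:E.
Proof. by rewrite /exceedance_cost unlock. Qed.

Lemma prob_gt_le_exceedance_cost Y c l : measurable_fun setT Y -> (0 <= l)%R ->
  P [set w | (c < Y w)%R] <= exceedance_cost P Y c l.
Proof.
move=> mY l0; rewrite exceedance_cost_integral.
have mA : measurable [set w | (c < Y w)%R] by exact: measurable_ltr_fun.
rewrite -(setIT [set w | _]) -integral_indic//.
apply: ge0_le_integral => //.
- exact/measurable_EFinP/measurable_indic.
- exact/measurable_EFinP/measurable_hinge.
- move=> w _; rewrite lee_fin indic_bool le_max.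
  have [cY|_] := ltP c (Y w); last by rewrite lexx orbT.
  by rewrite lerDr mulr_ge0// subr_ge0 ltW.
Qed.

Lemma exceedance_cost_le_mgf Y c l : measurable_fun setT Y ->
  exceedance_cost P Y c l <= 'M_P (fun w => Y w - c)%R l.
Proof.
move=> mY; rewrite exceedance_cost_integral mmt_gen_funE.
apply: ge0_le_integral => //.
- by move=> w _; rewrite lee_fin le_max lexx orbT.
- exact/measurable_EFinP/measurable_hinge.
- by apply/measurable_EFinP/measurable_expRM; exact: measurable_funB.
- by move=> w _; rewrite lee_fin ge_max expR_ge0 addrC expR_ge1Dx.
Qed.

Lemma prob_gt_le_inf_exceedance_cost Y c g : measurable_fun setT Y ->
  (0 <= g)%R -> P [set w | (c < Y w)%R] <= inf_exceedance_cost P Y c g.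
Proof.
move=> mY g0; apply: le_ereal_inf_tmp => _ [l gl <-].
by apply: prob_gt_le_exceedance_cost => //; exact: le_trans gl.
Qed.

Lemma inf_exceedance_cost_le Y c g l : (g <= l)%R ->
  inf_exceedance_cost P Y c g <= exceedance_cost P Y c l.
Proof. by move=> gl; apply: ereal_inf_lbound; exists l. Qed.

(** The cost is Lipschitz in the multiplier, with constant the mean distance of
    [Y] to [c], and grows at least linearly since [Y] exceeds [c + 1] with
    positive probability; so the infimum is that of a continuous function
    over a compact interval. *)
Lemma is_attained_exceedance Y c g : measurable_fun setT Y ->
  P.-integrable setT (fun w => (Y w)%:E) -> (0 <= g)%R ->
  0 < P [set w | (c + 1 <= Y w)%R] -> is_attained P Y c g.
Proof.
move=> mY intY g0 PY.
pose hinge (v l : R) : R := Num.max (l * v + 1)%R 0%R.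
have mh l := measurable_hinge c l mY.
have intV : P.-integrable setT (fun w => (Y w - c)%:E).
  have intc : P.-integrable setT (fun=> (- c)%:E) by exact: finite_measure_integrable_cst.
  exact: (integrable_EFinD intY intc).
have intaV : P.-integrable setT (fun w => `|Y w - c|%:E).
  exact: (integrable_norm intV).
have int1 : P.-integrable setT (fun=> 1%:E : \bar R).
  exact: finite_measure_integrable_cst.
have inth l : P.-integrable setT (fun w => (hinge (Y w - c) l)%:E).
  apply: (@le_integrable _ _ _ P setT measurableT _
      (fun w => (`|l| * `|Y w - c| + 1)%:E)).
  - by apply/measurable_EFinP; exact: mh.
  - move=> w _; rewrite !abse_EFin lee_fin -normrM.
    rewrite [leRHS]ger0_norm ?addr_ge0// ger0_norm ?le_max ?lexx ?orbT//.
    by rewrite ge_max lerD2r ler_norm addr_ge0.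
  - exact: integrable_EFinD (integrable_EFinZ _ intaV) int1.
pose f l : R := (\int[P]_w hinge (Y w - c) l)%R.
have fE l : exceedance_cost P Y c l = (f l)%:E.
  rewrite exceedance_cost_integral /f /Rintegral fineK//.
  exact: integrable_fin_num.
pose V : R := (\int[P]_w `|Y w - c|)%R.
have V0 : (0 <= V)%R by exact: Rintegral_ge0.
have lip l l' : (f l <= f l' + `|l - l'| * V)%R.
  rewrite /f /V -RintegralZl; [|exact: measurableT|exact: intaV].
  have i1 := integrable_EFinZ `|l - l'|%R intaV.
  rewrite -RintegralD; [|exact: measurableT|exact: inth|exact: i1].
  apply: le_Rintegral => //; first exact: inth.
    exact: integrable_EFinD (inth l') i1.
  move=> w _; rewrite -normrM /hinge; set v := (Y w - c)%R.
  rewrite ge_max; apply/andP; split.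
    have : (l' * v + 1 <= Num.max (l' * v + 1) 0)%R by rewrite le_max lexx.
    have := ler_norm ((l - l') * v)%R; lra.
  by rewrite addr_ge0// le_max lexx orbT.
have cf : continuous f.
  move=> l; apply/cvgrPdist_le => e e0.
  have := nbhsx_ballx l (e / (V + 1)).
  rewrite divr_gt0 ?ltr_wpDl// => /(_ isT); apply: filterS => x.
  rewrite /ball /= ltr_pdivlMr ?ltr_wpDl// => xe.
  have := lip l x; have := lip x l; rewrite (distrC x l).
  have := normr_ge0 (l - x)%R; rewrite ler_norml => ? ? ?.
  by apply/andP; split; lra.
pose p := fine (P [set w | (c + 1 <= Y w)%R]).
have mA : measurable [set w | (c + 1 <= Y w)%R].
  by rewrite -[X in measurable X]setTI; exact: measurable_fun_le.
have p0 : (0 < p)%R.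
  by rewrite fine_gt0// PY/= (le_lt_trans (probability_le1 P mA))// ltry.
have grow l : (0 <= l)%R -> (l * p <= f l)%R.
  move=> l0.
  have <- : (\int[P]_w \1_[set w | c + 1 <= Y w] w = p)%R.
    by rewrite /Rintegral integral_indic// setIT.
  have i1 : P.-integrable setT (fun w => (\1_[set w | (c + 1 <= Y w)%R] w : R)%:E).
    exact: integrable_indic.
  rewrite -RintegralZl; [|exact: measurableT|exact: i1].
  apply: le_Rintegral => //.
  - exact: integrable_EFinZ.
  - exact: inth.
  - move=> w _; rewrite indic_bool /hinge le_max.
    have [cY|_] := leP (c + 1)%R (Y w); last by rewrite mulr0 lexx orbT.
    apply/orP; left; rewrite mulr1.
    have : (0 <= l * (Y w - (c + 1)))%R by rewrite mulr_ge0 ?subr_ge0.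
    lra.
(* beyond [L] the linear lower bound is at least the cost at [g] *)
pose L := Num.max g (f g / p)%R.
have gL : (g <= L)%R by rewrite le_max lexx.
have [l lL minl] : exists2 l, l \in `[g, L] &
    forall t, t \in `[g, L] -> (f l <= f t)%R.
  by apply: EVT_min => //; exact: continuous_subspaceT.
have gl : (g <= l)%R by move: lL; rewrite in_itv /= => /andP[].
have glob t : (g <= t)%R -> (f l <= f t)%R.
  move=> gt; have [tL|Lt] := leP t L; first by rewrite minl// in_itv /= gt.
  rewrite (le_trans (minl g _)) ?in_itv /= ?lexx//.
  rewrite (le_trans _ (grow _ (le_trans g0 gt)))// -ler_pdivrMr//.
  by rewrite (le_trans _ (ltW Lt))// le_max lexx orbT.
exists l => //; apply/eqP; rewrite eq_le inf_exceedance_cost_le// andbT.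
by apply: le_ereal_inf_tmp => _ [t gt <-]; rewrite !fE lee_fin glob.
Qed.

End exceedance.

(** * Exponential rates *)

Section exponential_rate.
Context (R : realType).

Lemma cvg_log_rate (x : nat -> \bar R) (J : R) :
  (forall e : R, (0 < e)%R ->
     \forall n \near \oo, (expR (n%:R * (J - e)))%:E <= x n) ->
  (\forall n \near \oo, x n <= (expR (n%:R * J))%:E) ->
  (n%:R^-1)%:E * lne (x n) @[n --> \oo] --> J%:E.
Proof.
move=> lo up.
have rate (e : R) : (0 < e)%R -> \forall n \near \oo,
    exists2 r : R, (n%:R^-1)%:E * lne (x n) = r%:E & (J - e <= r <= J)%R.
  move=> e0; near=> n.
  have n0 : (0 < n%:R :> R)%R by rewrite ltr0n; near: n; exists 1%N.
  have loe : (expR (n%:R * (J - e)))%:E <= x n by near: n; exact: lo.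
  have upe : x n <= (expR (n%:R * J))%:E by near: n; exact: up.
  case: (x n) loe upe => [r| |]//; rewrite !lee_fin => loe upe.
  have r0 : (0 < r)%R by rewrite (lt_le_trans _ loe)// expR_gt0.
  exists (n%:R^-1 * ln r)%R; first by rewrite lne_EFin.
  rewrite ler_pdivlMl// ler_pdivrMl// -ler_expR -[X in _ && X]ler_expR.
  by rewrite lnK// loe.
pose y n := fine ((n%:R^-1)%:E * lne (x n)).
have ey : \forall n \near \oo, (y n)%:E = (n%:R^-1)%:E * lne (x n).
  by apply: filterS (rate 1%R ltr01) => n [r rE _]; rewrite /y rE.
apply: cvg_trans (near_eq_cvg ey) _.
apply: cvg_EFin => //; first by near=> n.
apply/cvgrPdist_le => e e0; apply: filterS (rate e e0) => n [r rE /andP[r1 r2]].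
by rewrite /comp /= /y rE /= ler_norml; apply/andP; split; lra.
Unshelve. all: by end_near. Qed.

End exponential_rate.

(** * Cramer's lower bound *)

Section cramer.
Context (d : measure_display) (T : measurableType d) (R : realType)
  (P : probability T R) (U : nat -> {RV P >-> R}) (U_iid : iid U)
  (M_fin : forall l : R, 'M_P (U 0%N) l < +oo).

Local Notation W a := (fun w => U 0%N w - a)%R.

Let mU0 : measurable_fun setT (U 0%N : T -> R).
Proof. by []. Qed.

Let mW a : measurable_fun setT (W a).
Proof. exact: measurable_shift. Qed.

Let W_fin a l : 'M_P (W a) l < +oo.
Proof. exact: mmt_gen_fun_shift_lty. Qed.

Let mgf_W_gt0 a l : (0 < mgf P (W a) l)%R.
Proof. exact: mgf_gt0. Qed.

Let log_mgfE l : log_mgf (U 0%N) l = (ln (mgf P (U 0%N) l))%:E.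
Proof.
rewrite /log_mgf mmt_gen_fun_mgf// lne_EFin//.
exact: mgf_gt0.
Qed.

(** The terms of the Legendre transform at [c] are the logarithms of the moment
    generating function of [U 0 - c], up to sign; its supremum is therefore read
    off a minimizer of that function. *)
Lemma legendre_term c l : (l * c)%:E - log_mgf (U 0%N) l =
  (- ln (mgf P (W c) l))%:E.
Proof.
rewrite log_mgfE -EFinB (mgf_shift mU0 M_fin) lnM ?posrE ?expR_gt0 ?mgf_gt0// expRK.
by congr EFin; ring.
Qed.

Lemma legendre_minimizer c l : (forall x, mgf P (W c) l <= mgf P (W c) x)%R ->
  legendre (log_mgf (U 0%N)) c = (- ln (mgf P (W c) l))%:E.
Proof.
move=> lmin; apply/eqP; rewrite eq_le; apply/andP; split.
  apply: ge_ereal_sup => _ [x _ <-]; rewrite legendre_term lee_fin lerN2.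
  by rewrite ler_ln ?posrE.
by rewrite -legendre_term; apply: ereal_sup_ubound; exists l.
Qed.

(** A finite Legendre transform on the positive half-line forbids an essential
    upper bound [b], which may be taken nonnegative: with such a bound
    [H l <= l * b] for [l >= 0], and the transform would be infinite at [b + 1]. *)
Lemma prob_ge_gt0 (b : R) :
  (forall x : R, (0 < x)%R -> legendre (log_mgf (U 0%N)) x \is a fin_num) ->
  0 < P [set w | (b <= U 0%N w)%R].
Proof.
move=> L_fin; rewrite lt0e measure_ge0 andbT; apply/negP => /eqP Pb0.
pose B := (Num.max b 0)%R.
have B0 : (0 <= B)%R by rewrite le_max lexx orbT.
have mA : measurable [set w | (b <= U 0%N w)%R].
  by rewrite -[X in measurable X]setTI; exact: measurable_fun_le.
have mgf_le l : (0 <= l)%R -> (mgf P (W B) l <= 1)%R.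
  move=> l0; rewrite -lee_fin -(mmt_gen_fun_mgf (mW B) (W_fin B l)) mmt_gen_funE.
  have -> : 1%:E = \int[P]_w 1%:E by rewrite integral_cst//= probability_setT mule1.
  apply: ae_ge0_le_integral => //.
  - exact/measurable_EFinP/measurable_expRM.
  - exists [set w | (b <= U 0%N w)%R]; split => // w /= h.
    rewrite leNgt; apply/negP => Ub; apply: h => _.
    rewrite lee_fin expR_le1 mulr_ge0_le0// subr_le0.
    by rewrite (le_trans (ltW Ub))// le_max lexx.
have LB l : (0 <= l)%R -> l%:E <= legendre (log_mgf (U 0%N)) (B + 1)%R.
  move=> l0; apply: le_trans (ereal_sup_ubound _); last by exists l.
  rewrite legendre_term lee_fin lerNr -(expRK (- l)%R) ler_ln ?posrE ?expR_gt0//.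
  rewrite (mgf_shift mU0 M_fin) mulrDr mulr1 opprD addrC expRD.
  rewrite -mulrA -(mgf_shift mU0 M_fin).
  by rewrite ler_piMr ?expR_ge0// mgf_le.
have B1 : (0 < B + 1)%R by rewrite ltr_wpDl.
have := LB (`|fine (legendre (log_mgf (U 0%N)) (B + 1)%R)| + 1)%R.
rewrite addr_ge0// => /(_ isT); rewrite -[X in _ <= X](fineK (L_fin _ B1)) lee_fin.
by have := ler_norm (fine (legendre (log_mgf (U 0%N)) (B + 1)%R)); lra.
Qed.

(** Law of large numbers under the tilt by [l]: the tilted mass of
    [|Z| >= n * delta] is a proportion at most [2 * q ^ n] of the whole, because
    moving the tilt from [l] by [t] gains [expR (- n * t * delta)] and costs only
    a factor [(1 + t ^ 2 * C / m) ^ n], with [m] the value of [mgf] at [l]. *)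
Lemma prob_centered_sum_ge a delta l C :
  (0 < delta)%R -> (0 <= l)%R -> (0 <= C)%R ->
  (forall t, (`|t| <= 1)%R ->
     (mgf P (W a) (l + t) <= mgf P (W a) l + t ^+ 2 * C)%R) ->
  exists2 q : R, (0 <= q < 1)%R & forall n,
    (mgf P (W a) l ^+ n * (1 - 2 * q ^+ n) <=
     expR (n%:R * (l * delta)) *
       fine (P [set w | `|centered_sum U a n w| < n%:R * delta]))%R.
Proof.
move=> delta0 l0 C0 hC; set m := mgf P (W a) l.
have m0 : (0 < m)%R by exact: mgf_W_gt0.
pose C' := (C / m)%R.
have C'0 : (0 <= C')%R by rewrite divr_ge0// ltW.
have mC : (m * C' = C)%R by rewrite mulrC divfK// gt_eqF.
(* [t] is small enough for the gain [t * delta] to beat the cost [t ^+ 2 * C'] *)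
pose t := (Num.min 1 (delta / (C' + 1)))%R.
have t0 : (0 < t)%R by rewrite lt_min ltr01 divr_gt0// ltr_wpDl.
have t1 : (t <= 1)%R by rewrite ge_min lexx.
have tC : (t * (C' + 1) <= delta)%R.
  by rewrite -ler_pdivlMr ?ltr_wpDl// ge_min lexx orbT.
pose q := (expR (- (t * delta)) * (1 + t ^+ 2 * C'))%R.
have q0 : (0 <= q)%R.
  by rewrite mulr_ge0 ?expR_ge0// addr_ge0// mulr_ge0// sqr_ge0.
have q1 : (q < 1)%R.
  apply: (@le_lt_trans _ _ (expR (- (t * delta) + t ^+ 2 * C'))%R).
    by rewrite expRD ler_wpM2l ?expR_ge0// expR_ge1Dx.
  rewrite expR_lt1; have := ler_wpM2l (ltW t0) tC; nra.
exists q; first by rewrite q0.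
move=> n.
have MZ x : 'M_P (centered_sum U a n) x = (mgf P (W a) x ^+ n)%:E.
  exact: (mmt_gen_fun_centered_sum U_iid n (W_fin a x)).
have mZ := measurable_centered_sum U a n.
have MZoo x : 'M_P (centered_sum U a n) x < +oo by rewrite MZ ltry.
have mgfZ x : mgf P (centered_sum U a n) x = (mgf P (W a) x ^+ n)%R.
  by apply: EFin_inj; rewrite -mmt_gen_fun_mgf.
have h := prob_norm_lt_ge (n%:R * delta) mZ MZoo l0 (ltW t0).
rewrite !mgfZ in h; rewrite mulrCA; apply: le_trans h.
have bd x : (mgf P (W a) x <= m + t ^+ 2 * C)%R ->
    (expR (- (t * (n%:R * delta))) * mgf P (W a) x ^+ n <= m ^+ n * q ^+ n)%R.
  move=> h; rewrite (_ : (- (t * (n%:R * delta)) = n%:R * - (t * delta))%R); last by ring.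
  rewrite expRM_natl -!exprMn; apply: lerXn2r; rewrite ?nnegrE.
  - by rewrite mulr_ge0 ?expR_ge0// ltW.
  - by rewrite (mulr_ge0 (ltW m0) q0).
  rewrite /q [leRHS]mulrCA ler_wpM2l ?expR_ge0// (le_trans h)//.
  by rewrite mulrDr mulr1 lerD2l mulrCA mC.
have b1 : (expR (- (t * (n%:R * delta))) * mgf P (W a) (l + t) ^+ n <=
    m ^+ n * q ^+ n)%R.
  by apply: bd; apply: hC; rewrite ger0_norm// ltW.
have b2 : (expR (- (t * (n%:R * delta))) * mgf P (W a) (l - t) ^+ n <=
    m ^+ n * q ^+ n)%R.
  by apply: bd; rewrite -sqrrN; apply: hC; rewrite normrN ger0_norm// ltW.
rewrite -/m; lra.
Qed.

Lemma exists_optimal_tilt a p : 'E_P[U 0%N] < a%:E -> (0 < p)%R ->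
  p%:E <= P [set w | (a + 1 <= U 0%N w)%R] ->
  exists l : R, [/\ (0 < l)%R, (forall x, mgf P (W a) l <= mgf P (W a) x)%R,
    (expR l * p <= 1)%R &
    exists2 C : R, (0 <= C)%R & forall t, (`|t| <= 1)%R ->
      (mgf P (W a) (l + t) <= mgf P (W a) l + t ^+ 2 * C)%R].
Proof.
move=> Ua p0 pP; apply: mgf_minimizer => //; first exact: expectation_shift_lt0.
rewrite (_ : [set w | _] = [set w | (a + 1 <= U 0%N w)%R])//.
by apply/seteqP; split => w /=; rewrite lerBrDl.
Qed.

(** The optimal tilt [l] is taken at the level [c + delta] rather than [c], so that
    [|Z| < n * delta] forces [c < Y_n]. The exponent then loses [l * delta]
    twice: once in comparing [mgf] at the levels [c + delta] and [c], once in
    bounding [expR (l * Z)] by [expR (l * (n * delta))]. Since [l] is bounded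
    independently of [delta], the choice of [delta] keeps this loss below [e / 2];
    the other half of [e] absorbs the factor [1 - 2 * q ^ n]. *)
Lemma prob_sample_mean_gt_ge c J e : 'E_P[U 0%N] < c%:E ->
  (forall b, 0 < P [set w | (b <= U 0%N w)%R]) ->
  (forall x, expR J <= mgf P (W c) x)%R -> (0 < e)%R ->
  \forall n \near \oo, (expR (n%:R * (J - e)))%:E <=
    P [set w | (c < sample_mean U n w)%R].
Proof.
move=> Uc Pb Jmin e0.
have mA b : measurable [set w | (b <= U 0%N w)%R].
  by rewrite -[X in measurable X]setTI; exact: measurable_fun_le.
have Pfin A : measurable A -> P A \is a fin_num.
  by move=> ?; exact: fin_num_measure.
pose p := fine (P [set w | (c + 2 <= U 0%N w)%R]).
have pE : p%:E = P [set w | (c + 2 <= U 0%N w)%R] by rewrite fineK// Pfin.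
have p0 : (0 < p)%R by rewrite -lte_fin pE.
have p1 : (p <= 1)%R by rewrite -lee_fin pE probability_le1.
pose L := (- ln p)%R.
have L0 : (0 <= L)%R by rewrite oppr_ge0 ln_le0.
pose delta := (Num.min 1 (e / (4 * (L + 1))))%R.
have L1 : (0 < 4 * (L + 1))%R by rewrite mulr_gt0// ltr_wpDl.
have delta0 : (0 < delta)%R by rewrite lt_min ltr01 divr_gt0.
have delta1 : (delta <= 1)%R by rewrite ge_min lexx.
have deltaL : (delta * (4 * (L + 1)) <= e)%R.
  by rewrite -ler_pdivlMr// ge_min lexx orbT.
pose a := (c + delta)%R.
have [|||l [l0 _ lp [C C0 hC]]] := @exists_optimal_tilt a p.
- by rewrite (lt_trans Uc)// lte_fin ltrDl.
- by [].
- rewrite pE; apply: le_measure; rewrite ?inE//.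
  move=> w /=; apply: le_trans; rewrite /a -addrA lerD2l; lra.
have lL : (l <= L)%R.
  rewrite -ler_expR expRN lnK ?posrE//.
  by rewrite -[(p^-1)%R]mul1r ler_pdivlMr.
have [q /andP[q0 q1] hq] := prob_centered_sum_ge delta0 (ltW l0) C0 hC.
have mJ : (expR (J - l * delta) <= mgf P (W a) l)%R.
  have -> : mgf P (W a) l = (expR (- (l * delta)) * mgf P (W c) l)%R.
    rewrite !(mgf_shift mU0 M_fin) mulrA -expRD; congr (expR _ * _)%R.
    by rewrite /a; ring.
  by rewrite expRD mulrC ler_wpM2l// expR_ge0.
have small (r : R) : (0 <= r < 1)%R -> \forall n \near \oo, (r ^+ n <= 1 / 4)%R.
  move=> /andP[r0 r1].
  have /cvgrPdist_le /(_ (1 / 4)%R) : (r ^+ n)%R @[n --> \oo] --> (0%R : R).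
    by apply: cvg_expr; rewrite ger0_norm.
  rewrite divr_gt0// => /(_ isT); apply: filterS => n.
  by rewrite sub0r normrN ger0_norm// exprn_ge0.
have eh1 : (expR (- (e / 2)) < 1)%R by rewrite expR_lt1 oppr_lt0 divr_gt0.
have eh0 := expR_ge0 (- (e / 2))%R.
have sm1 := small q; rewrite q0 q1 in sm1; have {}sm1 := sm1 isT.
have sm2 := small (expR (- (e / 2)))%R; rewrite eh0 eh1 in sm2.
have {}sm2 := sm2 isT.
near=> n.
have n0 : (0 < n)%N by near: n; exists 1%N.
have qn : (q ^+ n <= 1 / 4)%R by near: n.
have en : (expR (- (e / 2)) ^+ n <= 1 / 4)%R by near: n.
have nR : (0 < n%:R :> R)%R by rewrite ltr0n.
have mZ := measurable_centered_sum U a n.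
have mAZ : measurable [set w | (`|centered_sum U a n w| < n%:R * delta)%R].
  by apply: measurable_ltr_fun => //; exact: measurableT_comp.
apply: (@le_trans _ _ (P [set w | (`|centered_sum U a n w| <
    n%:R * delta)%R])); last first.
  apply: le_measure; rewrite ?inE//.
    apply: measurable_ltr_fun => //; apply: measurable_funM => //.
    exact: measurable_sum.
  move=> w /=; rewrite ltr_norml => /andP[+ _].
  rewrite /centered_sum sumrB sumr_const card_ord /sample_mean -(mulr_natl a).
  rewrite ltr_pdivlMl// /a => h; lra.
rewrite -[leRHS]fineK ?Pfin// lee_fin.
have e1 : (0 < expR (n%:R * (l * delta)))%R by exact: expR_gt0.
rewrite -(ler_pM2l e1); apply: le_trans (hq n).
have mn : (expR (J - l * delta) ^+ n <= mgf P (W a) l ^+ n)%R.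
  by apply: lerXn2r; rewrite ?nnegrE ?expR_ge0// ltW.
apply: (@le_trans _ _ (expR (J - l * delta) ^+ n * (1 / 4)))%R; last first.
  by apply: ler_pM => //; rewrite ?exprn_ge0 ?expR_ge0 ?divr_ge0//; lra.
apply: (@le_trans _ _ (expR (J - l * delta) ^+ n *
    expR (- (e / 2)) ^+ n))%R; last first.
  by rewrite ler_wpM2l// exprn_ge0 ?expR_ge0.
rewrite -!expRM_natl -!expRD ler_expR -!mulrDr ler_pM2l//.
have : (l * delta <= L * delta)%R by rewrite ler_wpM2r// ltW.
lra.
Unshelve. all: by end_near. Qed.

End cramer.

(** * The rate of the buffered probability of exceedance *)

Unset Implicit Arguments.

Theorem theorem4p1 (d : measure_display) (T : measurableType d) (R : realType)
    (P : probability T R) (U : nat -> {RV P >-> R})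
    (U_iid : iid U)
    (M_fin : forall l : R, 'M_P (U 0%N) l < +oo)
    (L_fin : forall b : R, (0 < b)%R ->
       legendre (log_mgf (U 0%N)) b \is a fin_num)
    (c g : R) (hc : 'E_P[U 0%N] < c%:E) (hg : (0 <= g)%R) :
  [/\ forall n : nat, (0 < n)%N -> is_attained P (sample_mean U n) c g,
      (n%:R^-1)%:E * lne (inf_exceedance_cost P (sample_mean U n) c g)
        @[n --> \oo] --> - legendre (log_mgf (U 0%N)) c
    & (n%:R^-1)%:E * lne (P [set w | (c < sample_mean U n w)%R])
        @[n --> \oo] --> - legendre (log_mgf (U 0%N)) c].
Proof.
have Pb b : 0 < P [set w | (b <= U 0%N w)%R] by exact: prob_ge_gt0.
have mA b : measurable [set w | (b <= U 0%N w)%R].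
  by rewrite -[X in measurable X]setTI; exact: measurable_fun_le.
have Pfin b : P [set w | (b <= U 0%N w)%R] \is a fin_num.
  exact: fin_num_measure.
have mY n : measurable_fun setT (sample_mean U n).
  by apply: measurable_funM => //; exact: measurable_sum.
have p0 b : (0 < fine (P [set w | (b <= U 0%N w)%R]))%R.
  by rewrite -lte_fin fineK.
have [|l [l0 lmin _ _]] := exists_optimal_tilt M_fin hc (p0 (c + 1)%R).
  by rewrite fineK.
set m := mgf P (fun w => U 0%N w - c)%R in lmin.
pose J := ln (m l).
have m0 x : (0 < m x)%R.
  by apply: mgf_gt0; [exact: measurable_shift|exact: mmt_gen_fun_shift_lty].
have eJ : expR J = m l by rewrite lnK ?posrE.
have Lc : - legendre (log_mgf (U 0%N)) c = J%:E.
  by rewrite (legendre_minimizer M_fin lmin) EFinN oppeK.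
have MZ n x : 'M_P (centered_sum U c n) x = (m x ^+ n)%:E.
  by apply: mmt_gen_fun_centered_sum => //; exact: mmt_gen_fun_shift_lty.
have ZE n w : (0 < n)%N -> (n%:R * (sample_mean U n w - c) = centered_sum U c n w)%R.
  move=> n0; rewrite /sample_mean /centered_sum mulrBr mulrA divff ?pnatr_eq0 -?lt0n//.
  by rewrite mul1r sumrB sumr_const card_ord mulr_natl.
have lower e : (0 < e)%R -> \forall n \near \oo, (expR (n%:R * (J - e)))%:E <=
    P [set w | (c < sample_mean U n w)%R].
  by move=> e0; apply: prob_sample_mean_gt_ge => // x; rewrite eJ.
have upper : \forall n \near \oo,
    inf_exceedance_cost P (sample_mean U n) c g <= (expR (n%:R * J))%:E.
  near=> n.
  have n0 : (0 < n)%N by near: n; exists 1%N.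
  have gn : (g <= n%:R * l)%R.
    by rewrite -ler_pdivrMr//; near: n; exact: nbhs_infty_ger.
  rewrite (le_trans (inf_exceedance_cost_le _ _ _ gn))//.
  rewrite (le_trans (exceedance_cost_le_mgf _ _ _ (mY n)))//.
  rewrite expRM_natl eJ -MZ !mmt_gen_funE le_eqVlt; apply/orP; left; apply/eqP.
  by apply: eq_integral => w _; rewrite -ZE// mulrCA mulrA.
have sandwich n : P [set w | (c < sample_mean U n w)%R] <=
    inf_exceedance_cost P (sample_mean U n) c g.
  exact: prob_gt_le_inf_exceedance_cost.
rewrite Lc; split.
- move=> n n0; apply: is_attained_exceedance => //.
    have iZ := integrable_of_mgf (measurable_centered_sum U c n).
    have {}iZ : P.-integrable setT (fun w => (centered_sum U c n w)%:E).
      by apply: iZ => x; rewrite MZ ltry.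
    have ic : P.-integrable setT (fun=> c%:E).
      exact: finite_measure_integrable_cst.
    have := integrable_EFinD (integrable_EFinZ n%:R^-1 iZ) ic.
    apply: eq_integrable => // w _.
    by rewrite -ZE// mulKf ?subrK// pnatr_eq0 -lt0n.
  apply: lt_le_trans (prob_sample_mean_ge U_iid (c + 1)%R n0).
  by rewrite lte_fin exprn_gt0.
- apply: cvg_log_rate => // e /lower; apply: filterS => n h.
  exact: le_trans h (sandwich n).
- apply: cvg_log_rate => //; apply: filterS upper => n.
  exact: le_trans (sandwich n).
Unshelve. all: by end_near. Qed.
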